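(* There exists $u_0\in H^1(\mathbb{R})$ such that $$\|u_0\|_{L^2}=\sqrt{4\pi}\quad\text{and}\quad P_1(u_0)>0,$$ where $P_1(u)=\Im\langle\partial_xu,u\rangle-\frac12\|u\|_{L^4}^4$.
   Context: $H^1(\mathbb{R})$ is the Sobolev space of complex valued functions on $\mathbb{R}$. $\langle f,g\rangle=\int_{\mathbb{R}}f(x)\overline{g(x)}\,dx$ is the standard inner product of $L^2(\mathbb{R})$, so that $P_1(u)=\Im\int_{\mathbb{R}}\overline{u}\,\partial_xu\,dx-\frac12\int_{\mathbb{R}}|u|^4\,dx$ (the momentum functional of the derivative nonlinear Schrödinger equation $i\partial_tu+\partial_x^2u=i\partial_x(|u|^2u)$). *)

(* Defs.v *)
From HB Require Import structures.
From mathcomp Require Import all_boot all_order all_algebra.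
From mathcomp Require Import all_classical all_reals all_analysis.
From mathcomp Require Import complex.

Set Implicit Arguments.
Unset Strict Implicit.
Unset Printing Implicit Defensive.

Import Order.TTheory GRing.Theory Num.Theory.
Import numFieldNormedType.Exports.
Import ComplexField.Normc.

Local Open Scope classical_set_scope.
Local Open Scope ring_scope.
Local Open Scope complex_scope.

Section definitions.
Context {R : realType}.

Local Notation mu := (@lebesgue_measure R).

Implicit Types u v f g : R -> R[i].

(* The Rintegrals return 0 on divergent integrals; below, all integrands are
   products of two L^2 functions. *)
Definition cintegral f : R[i] :=
  (\int[mu]_x (complex.Re (f x)))%R +i* (\int[mu]_x (complex.Im (f x)))%R.

Definition inner f g : R[i] := cintegral (fun x => f x * (g x)^*).

Definition cmeasurable f : Prop :=
  measurable_fun [set: R] (fun x => complex.Re (f x)) /\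
  measurable_fun [set: R] (fun x => complex.Im (f x)).

(* Extended-real valued: +oo when f is not in L^p. *)
Definition cLnorm (p : R) f : \bar R :=
  Lnorm mu p%:E (fun x => (normc (f x))%:E).

Definition L2 f : Prop := cmeasurable f /\ (cLnorm 2 f < +oo)%E.

Definition test_function (phi : R -> R) : Prop :=
  (forall (n : nat) (x : R), derivable (derive1n n phi) x 1) /\
  compact (closure [set x | phi x != 0]).

(* Real-valued test functions suffice: by linearity, the identity then also
   holds for complex-valued ones. *)
Definition is_weak_derivative u v : Prop :=
  forall phi : R -> R, test_function phi ->
    cintegral (fun x => u x * (derive1 phi x)%:C) =
    - cintegral (fun x => v x * (phi x)%:C).

Definition H1 u : Prop :=
  L2 u /\ exists v, L2 v /\ is_weak_derivative u v.

(* The weak derivative is unique only up to a null set, which does not affect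
   any integral; an arbitrary representative is chosen, and cst 0 is returned
   when u has no weak derivative in L^2. *)
Definition weak_derivative u : R -> R[i] :=
  xget (cst 0) [set v | L2 v /\ is_weak_derivative u v].

(* Extended-real valued so that no convention is needed for the L^4 norm; for
   u in H1 the value is finite. *)
Definition P1 u : \bar R :=
  ((complex.Im (inner (weak_derivative u) u))%:E
     - (2^-1)%:E * cLnorm 4 u ^+ 4)%E.

End definitions.

(* Main.v *)
Require Import Defs.
From mathcomp Require Import all_boot all_order all_algebra.
From mathcomp Require Import all_classical all_reals all_analysis.
From mathcomp Require Import complex.
From mathcomp Require Import measurable_realfun ring lra.

(** The momentum is not bounded above on a sphere of L^2: multiplying a real
    profile f by the plane wave e^(ikx) leaves |u| = |f|, hence the mass and the
    quartic term, unchanged, while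
      Im <u', u> = k ||f||_2^2
    grows linearly in k.  So any f of mass 4 pi will do, once k is large;
    k = ||f||_4^4 + 1 suffices because 4 pi > 1/2.

    The weak derivative entering P1 is an arbitrarily chosen L^2 function v, of
    which only the integrals against test functions are known.  Rather than
    proving that v is unique almost everywhere, the profile f is taken smooth
    with compact support: then a = Re u and b = Im u are themselves admissible
    test functions, and testing v against them gives
      Im <v, u> = int (Im v) a - int (Re v) b = int (a b' - b a')
    whatever v is (Im_inner_weak_derivative).  The integrand is pointwise
    k f^2 (modulation_wronskian).

    This requires a nonzero smooth function of compact support.  It is built
    from e^(-1/x) extended by 0 to x <= 0, whose smoothness comes from
    considering all the functions p(1/x) e^(-1/x), p a polynomial, at once: that
    family is stable under derivation (is_derive_flat), and so is the class of
    functions generated from it, sin and cos (elementary_derive). *)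

Import Order.TTheory GRing.Theory Num.Theory.
Import numFieldNormedType.Exports.
Import ComplexField.Normc.
Local Open Scope classical_set_scope.
Local Open Scope complex_scope.
Local Open Scope ring_scope.

(** * Smooth functions flat at the origin *)

Definition flat {R : realType} (p : {poly R}) (x : R) : R :=
  if 0 < x then p.[x^-1] * expR (- x^-1) else 0.

Lemma poly_growth {R : realType} (p : {poly R}) :
  exists n A, 0 <= A /\ forall y : R, 1 <= y -> `|p.[y]| <= A * y ^+ n.
Proof.
elim/poly_ind: p => [|p c [n [A [A0 pA]]]].
  by exists 0%N, 0; split => // y _; rewrite horner0 normr0 mul0r.
exists n.+1, (A + `|c|); split; first by rewrite addr_ge0.
move=> y y1; rewrite hornerMXaddC mulrDl (le_trans (ler_normD _ _))// lerD//.
  by rewrite normrM exprSr mulrA (ger0_norm (le_trans ler01 y1)) ler_wpM2r ?pA//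
    (le_trans ler01).
by rewrite ler_peMr// exprn_ege1.
Qed.

(** Linear vanishing at the origin, for every p: the bound for 'X * p is what
    makes the difference quotient of flat p at 0 tend to 0. *)
Lemma flat_le {R : realType} (p : {poly R}) :
  exists2 C, 0 <= C & forall x, x <= 1 -> `|flat p x| <= C * `|x|.
Proof.
have [n [A [A0 pA]]] := poly_growth p.
exists (A * (n.+1)`!%:R) => [|x x1]; first by rewrite mulr_ge0.
rewrite /flat; case: ltP => [x0|_]; last by rewrite normr0 !mulr_ge0.
have y1 : 1 <= x^-1 by rewrite invf_ge1.
have y0 : 0 < x^-1 by rewrite invr_gt0.
rewrite (gtr0_norm x0) normrM (gtr0_norm (expR_gt0 _)) expRN ler_pdivrMr ?expR_gt0//.
apply: (le_trans (pA _ y1)).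
rewrite -!mulrA ler_wpM2l//.
(* With y = 1/x, the bound y^(n+1) / (n+1)! <= e^y beats the growth A y^n of p
   by a factor y. *)
have := expR_ge1Dxn n (ltW y0).
have f0 : 0 < (n.+1)`!%:R :> R by rewrite ltr0n fact_gt0.
move=> H; have {}H : x^-1 ^+ n.+1 / (n.+1)`!%:R <= expR x^-1.
  by apply: le_trans H; rewrite lerDr.
have {}H : x^-1 ^+ n.+1 <= expR x^-1 * (n.+1)`!%:R by rewrite -ler_pdivrMr.
have -> : x^-1 ^+ n = x * x^-1 ^+ n.+1 by rewrite exprS mulrA divff ?gt_eqF// mul1r.
by rewrite mulrCA ler_wpM2l ?(ltW x0)// mulrC.
Qed.

(** For x > 0 this is the product rule, with (1/x)' = - (1/x)^2; the derivative
    is again of the same form, which is why the polynomial p is carried along. *)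
Lemma is_derive_flat {R : realType} (p : {poly R}) (x : R) :
  is_derive x 1 (flat p) (flat ('X^2 * (p - p^`())) x).
Proof.
have [x0|x0|->] := ltgtP x 0.
- rewrite {2}/flat ltNge ltW//=.
  apply: (@near_eq_is_derive _ _ _ (cst 0)) => //.
  near=> y; rewrite /flat ltNge ltW//=; near: y; exact: lt_nbhsl.
- apply: (@near_eq_is_derive R R R (fun x : R => p.[x^-1] * expR (- x^-1))).
    near=> y; rewrite /flat ifT//; near: y; exact: lt_nbhsr.
  have xN0 : x != 0 by rewrite gt_eqF.
  have dV : is_derive x 1 (fun y : R => y^-1) (- x ^- 2).
    by apply: is_derive_eq; first exact: is_deriveV; rewrite scaler1.
  apply: is_derive_eq.
  rewrite /flat x0 !hornerE /GRing.scale/= -exprVn; ring.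
- rewrite {2}/flat ltxx.
  suff H : h^-1 *: ((flat p \o shift (0:R)) (h *: (1:R)) - flat p 0) @[h --> (0:R)^'] --> (0 : R).
    split; first by apply/cvg_ex; exists 0.
    exact: cvg_lim.
  have [C C0 pC] := flat_le ('X * p).
  apply/cvgrPdist_le => e e0; near=> h.
  have h0 : h != 0 by near: h; exact: nbhs_dnbhs_neq.
  rewrite sub0r normrN /= addr0 /GRing.scale/= mulr1 {2}/flat ltxx subr0.
  have -> : h^-1 * flat p h = flat ('X * p) h.
    by rewrite /flat; case: ifP; rewrite ?mulr0// ?hornerE ?mulrA.
  have h1 : `|h| <= 1 by near: h; exact: (@dnbhs0_le R R).
  have he : `|h| <= e / (C + 1).
    by near: h; apply: (@dnbhs0_le R R); rewrite divr_gt0// ltr_wpDl.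
  apply: le_trans (pC _ (le_trans (ler_norm _) h1)) _.
  rewrite ler_pdivlMr in he; last by rewrite ltr_wpDl.
  apply: le_trans he; rewrite mulrC ler_wpM2l//; lra.
Unshelve. all: by end_near.
Qed.

(** * A class of smooth functions *)

(** Only stability under derivation matters here.  Taking the closure of the
    generators under sums, products and affine changes of variable makes that
    stability an immediate induction, with no Leibniz formula for higher
    derivatives. *)
Inductive elementary {R : realType} : (R -> R) -> Prop :=
| elementary_cst c : elementary (fun=> c)
| elementaryD f g : elementary f -> elementary g -> elementary (f \+ g)
| elementaryM f g : elementary f -> elementary g -> elementary (f \* g)
| elementary_sin : elementary sin
| elementary_cos : elementary cos
| elementary_flat p : elementary (flat p)
| elementary_affine f a b : elementary f -> elementary (fun x => f (a * x + b)).

Lemma elementary_scale {R : realType} (f : R -> R) a :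
  elementary f -> elementary (fun x => f (a * x)).
Proof.
move=> /elementary_affine => /(_ a 0).
by congr elementary; apply/funext => x; rewrite addr0.
Qed.

Lemma elementary_derive {R : realType} (f : R -> R) : elementary f ->
  exists2 g : R -> R, elementary g & forall x : R, is_derive x 1 f (g x).
Proof.
elim=> {f} [c|f g _ [df edf hf] _ [dg edg hg]|f g ef [df edf hf] eg [dg edg hg]||
  |p|f a b ef [df edf hf]].
- by exists (fun=> 0); [exact: elementary_cst|move=> x; exact: is_derive_cst].
- by exists (df \+ dg); [exact: elementaryD|move=> x; exact: is_deriveD].
- exists ((f \* dg) \+ (g \* df)); last by move=> x; exact: is_deriveM.
  by apply: elementaryD; exact: elementaryM.
- by exists cos; [exact: elementary_cos|move=> x; exact: is_derive_sin].
- exists ((fun=> -1) \* sin).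
    by apply: elementaryM; [exact: elementary_cst|exact: elementary_sin].
  by move=> x; apply: is_derive_eq; rewrite /= mulN1r.
- exists (flat ('X^2 * (p - p^`()))); first exact: elementary_flat.
  by move=> x; exact: is_derive_flat.
- exists ((fun x => df (a * x + b)) \* (fun=> a)).
    by apply: elementaryM; [exact: elementary_affine|exact: elementary_cst].
  move=> x; apply: (@is_derive1_comp _ f (fun x => a * x + b)) => //.
  have -> : (fun x => a * x + b) = a *: (id : R -> R) + cst b by apply/funext.
  by apply: is_derive_eq; rewrite addr0 /GRing.scale/= mulr1.
Qed.

Lemma elementary_smooth {R : realType} (f : R -> R) : elementary f ->
  forall n (x : R), derivable (derive1n n f) x 1.
Proof.
move=> ef n; suff efn : elementary (derive1n n f).
  by move=> x; have [g _ /(_ x)[]] := elementary_derive _ efn.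
elim: n => // n IH; rewrite derive1nS; have [g eg fg] := elementary_derive _ IH.
suff -> : derive1 (derive1n n f) = g by [].
by apply/funext => x; rewrite derive1E (@derive_val _ _ _ _ _ _ _ (fg x)).
Qed.

(** * Test functions and integration by parts *)

Section test_functions.
Context {R : realType}.
Local Notation mu := (@lebesgue_measure R).
Implicit Types f g : R -> R.

Lemma test_function_bounded_support f : test_function f ->
  exists M, 0 < M /\ forall x, M <= `|x| -> f x = 0.
Proof.
move=> [_ /compact_bounded[M0 [_ H]]].
have [M M0M Mp] : exists2 M, M0 < M & 0 < M.
  by exists (`|M0| + 1); rewrite ?(le_lt_trans (ler_norm M0))// ?ltrDl// ltr_wpDl.
exists (M + 1); split; first by rewrite addr_gt0.
move=> x Mx; apply/eqP/negPn/negP => /(@subset_closure _ [set x | f x != 0]) /(H _ M0M) /=.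
by apply/negP; rewrite -ltNge (lt_le_trans _ Mx)// ltrDl.
Qed.

Lemma bounded_support_test_function f M : (forall n (x : R), derivable (derive1n n f) x 1) ->
  (forall x, M <= `|x| -> f x = 0) -> test_function f.
Proof.
move=> sf fM; split=> //.
apply: (@subclosed_compact _ _ `[-M, M]).
- exact: closed_closure.
- exact: segment_compact.
- rewrite closureEbigcap => y; apply; split=> [|x /= fx]; first exact: interval_closed.
  rewrite in_itv/= -ler_norml leNgt; apply: contra fx => /ltW /fM ->; exact/eqP.
Qed.

Lemma test_function_derivable f x : test_function f -> derivable f x 1.
Proof. by move=> [/(_ 0%N)]. Qed.

Lemma test_function_continuous f : test_function f -> continuous f.
Proof.
move=> tf x; apply: differentiable_continuous; apply/derivable1_diffP.
exact: test_function_derivable.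
Qed.

Lemma test_function_derive1 f : test_function f -> test_function (derive1 f).
Proof.
move=> tf; have [M [M0 fM]] := test_function_bounded_support f tf.
(* Beyond M + 1 every point has a whole neighbourhood on which f vanishes. *)
apply: (@bounded_support_test_function _ (M + 1)).
  by move=> n x; have := tf.1 n.+1 x; rewrite /derive1n -iterSr.
move=> x Mx; rewrite derive1E.
have /near_eq_derive -> : \forall y \near x, f y = cst 0 y.
  near=> y; apply: fM.
  have : `|x - y| < 1 by near: y; exact: (@nbhsx_ballx R R).
  by have := ler_distD y x 0; rewrite !subr0; lra.
by rewrite derive_cst.
Unshelve. all: by end_near. Qed.

(** Turns integrals over the line into integrals over a compact interval, the
    setting of the fundamental theorem of calculus. *)
Lemma bounded_support_patch f M : (forall x, M <= `|x| -> f x = 0) -> f \_ `[-M, M] = f.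
Proof.
move=> fM; apply/funext => x; rewrite patchE; case: ifPn => // xM.
rewrite fM// ltW// ltNge ler_norml; apply: contra xM.
by rewrite inE/= in_itv.
Qed.

Lemma continuous_integrable f M : continuous f ->
  (forall x, M <= `|x| -> f x = 0) -> mu.-integrable setT (EFin \o f).
Proof.
move=> cf fM; rewrite -(bounded_support_patch _ _ fM) -restrict_EFin.
apply/(integrable_mkcond _ _).1 => //.
apply: continuous_compact_integrable; first exact: segment_compact.
exact: continuous_subspaceT.
Qed.

Lemma integrable_continuousM_test f g : continuous f -> test_function g ->
  mu.-integrable setT (EFin \o (f \* g)).
Proof.
move=> cf tg; have [M [_ gM]] := test_function_bounded_support g tg.
apply: (@continuous_integrable _ M) => [x|x /gM /= ->]; last by rewrite mulr0.
by apply: continuousM; [exact: cf|exact: test_function_continuous].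
Qed.

Lemma test_function_integration_by_parts f g : test_function f -> test_function g ->
  \int[mu]_x (f x * (derive1 g) x) = - \int[mu]_x ((derive1 f) x * g x).
Proof.
move=> tf tg; have [M [M0 gM]] := test_function_bounded_support g tg.
have tdg := test_function_derive1 _ tg.
have [M' [M'0 gM']] := test_function_bounded_support _ tdg.
pose N := Num.max M M'.
have N0 : 0 < N by rewrite lt_max M0.
have gN x : N <= `|x| -> g x = 0 by rewrite ge_max => /andP[/gM].
have gN' x : N <= `|x| -> (derive1 g) x = 0 by rewrite ge_max => /andP[_ /gM'].
rewrite -(bounded_support_patch (fun x => f x * derive1 g x) N);
  last by move=> x /gN' ->; rewrite mulr0.
rewrite -(bounded_support_patch (fun x => derive1 f x * g x) N);
  last by move=> x /gN ->; rewrite mulr0.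
rewrite -!Rintegral_mkcond.
have LR h : test_function h -> derivable_oo_LRcontinuous h (- N) N.
  move=> th; split=> [x _||]; first exact: test_function_derivable.
    by apply: cvg_at_right_filter; exact: test_function_continuous.
  by apply: cvg_at_left_filter; exact: test_function_continuous.
rewrite (@Rintegration_by_parts _ f g (derive1 f) (derive1 g)) ?gtrN//.
- have gp : g N = 0 by apply: gN; rewrite (gtr0_norm N0).
  have gm : g (- N) = 0 by apply: gN; rewrite normrN (gtr0_norm N0).
  by rewrite gp gm !mulr0 subr0 sub0r.
- by apply: continuous_subspaceT; apply: test_function_continuous; exact: test_function_derive1.
- exact: LR.
- by apply: continuous_subspaceT; exact: test_function_continuous.
- exact: LR.
Qed.

End test_functions.

(** * Weak derivatives of test functions *)

Section L2_lemmas.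
Context {R : realType}.
Local Notation mu := (@lebesgue_measure R).
Implicit Types (a b : R -> R) (u v : R -> R[i]).

Lemma sqr_normc_ReIm (z : R[i]) : normc z ^+ 2 = complex.Re z ^+ 2 + complex.Im z ^+ 2.
Proof. by case: z => x y /=; rewrite sqr_sqrtr// addr_ge0// sqr_ge0. Qed.

Lemma normc_ge0 (z : R[i]) : 0 <= normc z.
Proof. by case: z => x y /=; exact: sqrtr_ge0. Qed.

Lemma poweR_cLnorm u n : (0 < n)%N ->
  (cLnorm n%:R u `^ n%:R = \int[mu]_x (normc (u x) ^+ n)%:E)%E.
Proof.
move=> n0; rewrite /cLnorm poweR_Lnorm ?pnatr_eq0 -?lt0n//.
by apply: eq_integral => x _;
  rewrite abse_EFin poweR_EFin ger0_norm ?normc_ge0// powR_mulrn// normc_ge0.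
Qed.

Lemma cLnormE u n : (0 < n)%N ->
  mu.-integrable setT (fun x => (normc (u x) ^+ n)%:E) ->
  cLnorm n%:R u = ((\int[mu]_x (normc (u x) ^+ n)) `^ n%:R^-1)%:E.
Proof.
move=> n0 iu.
rewrite -poweR_EFin /Rintegral fineK; last exact: integrable_fin_num.
rewrite -poweR_cLnorm// -poweRrM divff ?pnatr_eq0 -?lt0n// poweRe1//.
exact: Lnorm_ge0.
Qed.

Lemma L2_integrable_sqr v : L2 v -> mu.-integrable setT (fun x => (normc (v x) ^+ 2)%:E).
Proof.
move=> [[mr mi] voo]; apply/integrableP; split.
  apply/measurable_EFinP; rewrite (_ : (fun _ => _) =
      (fun x => complex.Re (v x) ^+ 2 + complex.Im (v x) ^+ 2)).
    by apply: measurable_funD; exact: measurable_funX.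
  by apply/funext => x; rewrite sqr_normc_ReIm.
under eq_integral do rewrite gee0_abs ?lee_fin ?sqr_ge0//.
by rewrite -poweR_cLnorm// poweR_lty.
Qed.

(** Needed to split the integral of (Im v) a - (Re v) b; the domination is
    |x y| <= x^2 + y^2. *)
Lemma L2_integrableM v a : L2 v -> test_function a ->
  mu.-integrable setT (EFin \o (fun x => complex.Re (v x) * a x)) /\
  mu.-integrable setT (EFin \o (fun x => complex.Im (v x) * a x)).
Proof.
move=> Lv ta.
have ia := integrable_continuousM_test a a (test_function_continuous _ ta) ta.
have ma := continuous_measurable_fun (test_function_continuous _ ta).
have i2 := integrableD measurableT (L2_integrable_sqr _ Lv) ia.
have [[mr mi] _] := Lv.
split; apply: le_integrable i2 => //.
- by apply/measurable_EFinP; exact: measurable_funM.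
- move=> x _; rewrite /= lee_fin sqr_normc_ReIm (ger0_norm (addr_ge0 _ _)) ?addr_ge0 ?sqr_ge0//.
  by rewrite ler_norml; apply/andP; split; nra.
- by apply/measurable_EFinP; exact: measurable_funM.
- move=> x _; rewrite /= lee_fin sqr_normc_ReIm (ger0_norm (addr_ge0 _ _)) ?addr_ge0 ?sqr_ge0//.
  by rewrite ler_norml; apply/andP; split; nra.
Qed.

Lemma L2_test a b : test_function a -> test_function b ->
  L2 (fun x => a x +i* b x).
Proof.
move=> ta tb.
have ca := test_function_continuous _ ta.
have cb := test_function_continuous _ tb.
split; first by split; exact: continuous_measurable_fun.
rewrite (@cLnormE _ 2)// ?ltry//.
have := integrableD measurableT (integrable_continuousM_test _ _ ca ta)
  (integrable_continuousM_test _ _ cb tb).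
by apply: eq_integrable => // x _; rewrite sqr_normc_ReIm /= !expr2.
Qed.

Lemma cintegralM (f : R -> R[i]) (p : R -> R) :
  cintegral (fun x => f x * (p x)%:C) =
  (\int[mu]_x (complex.Re (f x) * p x)) +i* (\int[mu]_x (complex.Im (f x) * p x)).
Proof.
rewrite /cintegral; congr (_ +i* _); apply: eq_Rintegral => x _;
  by case: (f x) => r i /=; simpc.
Qed.

Lemma test_is_weak_derivative a b : test_function a -> test_function b ->
  is_weak_derivative (fun x => a x +i* b x) (fun x => derive1 a x +i* derive1 b x).
Proof.
by move=> ta tb p tp; rewrite !cintegralM/= !test_function_integration_by_parts.
Qed.

(** This holds for every weak derivative v, without knowing that v is almost
    everywhere the classical derivative: Re u and Im u are themselves test
    functions, and the two components of v are only ever integrated against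
    them. *)
Lemma Im_inner_weak_derivative a b v : test_function a -> test_function b ->
  L2 v -> is_weak_derivative (fun x => a x +i* b x) v ->
  complex.Im (inner v (fun x => a x +i* b x)) =
  \int[mu]_x (a x * derive1 b x - b x * derive1 a x).
Proof.
move=> ta tb Lv wv.
have [ca cb] := (test_function_continuous _ ta, test_function_continuous _ tb).
have := wv _ tb; rewrite !cintegralM/= => -[vb _].
have := wv _ ta; rewrite !cintegralM/= => -[_ va].
rewrite /inner /cintegral/=.
transitivity (\int[mu]_x (complex.Im (v x) * a x - complex.Re (v x) * b x)).
  by apply: eq_Rintegral => x _; case: (v x) => r i /=; ring.
rewrite !RintegralB//; [|exact: integrable_continuousM_test (test_function_derive1 _ _)..|
  by have [] := L2_integrableM _ _ Lv ta|by have [] := L2_integrableM _ _ Lv tb].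
by rewrite va vb opprK addrC.
Qed.

Lemma test_H1 a b : test_function a -> test_function b -> H1 (fun x => a x +i* b x).
Proof.
move=> ta tb; split; first exact: L2_test.
exists (fun x => derive1 a x +i* derive1 b x); split.
  by apply: L2_test; exact: test_function_derive1.
exact (test_is_weak_derivative a b ta tb).
Qed.

Lemma P1_test a b : test_function a -> test_function b ->
  P1 (fun x => a x +i* b x) =
  (\int[mu]_x (a x * derive1 b x - b x * derive1 a x)
   - 2^-1 * \int[mu]_x (a x ^+ 2 + b x ^+ 2) ^+ 2)%:E.
Proof.
move=> ta tb; set u := fun x => _.
have [_ H1u] := test_H1 _ _ ta tb.
have [Lw ww] : L2 (weak_derivative u) /\ is_weak_derivative u (weak_derivative u).
  rewrite /weak_derivative.
  exact: (@xgetPex _ (cst 0) [set v | L2 v /\ is_weak_derivative u v] H1u).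
have n4 x : normc (u x) ^+ 4 = (a x ^+ 2 + b x ^+ 2) ^+ 2.
  by rewrite (exprM _ 2 2) sqr_normc_ReIm.
have [ca cb] := (test_function_continuous _ ta, test_function_continuous _ tb).
have i4 : mu.-integrable setT (fun x => (normc (u x) ^+ 4)%:E).
  have [M [_ aM]] := test_function_bounded_support _ ta.
  have [M' [_ bM]] := test_function_bounded_support _ tb.
  pose q x := a x * a x + b x * b x.
  have cq : continuous q.
    by move=> x; apply: (@continuousD _ _ _ (a \* a) (b \* b));
      apply: continuousM; (exact: ca || exact: cb).
  apply: eq_integrable (@continuous_integrable _ (q \* q) (Num.max M M') _ _) => //.
  - by move=> x _; rewrite n4 /= /q !expr2.
  - by move=> x; apply: continuousM; exact: cq.
  - move=> x; rewrite ge_max => /andP[/aM ax /bM bx].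
    by rewrite /= /q ax bx !mulr0 addr0 mulr0.
rewrite /P1 Im_inner_weak_derivative// (@cLnormE u 4)// -EFin_expe -EFinM -EFinB.
rewrite -powR_mulrn ?powR_ge0// -powRrM mulVf ?pnatr_eq0// powRr1.
  by congr (_ - _ * _)%:E; apply: eq_Rintegral => x _; exact: n4.
by apply: Rintegral_ge0 => x _; rewrite exprn_ge0 ?normc_ge0.
Qed.

End L2_lemmas.

(** * A modulated bump *)

Section bump.
Context {R : realType}.
Local Notation mu := (@lebesgue_measure R).
Implicit Types f : R -> R.

Definition bump (x : R) : R := flat 1 x * flat 1 (-1 * x + 1).

Lemma elementary_bump : elementary bump.
Proof.
by apply: elementaryM; [|apply: elementary_affine]; exact: elementary_flat.
Qed.

Lemma bump_eq0 x : 1 <= `|x| -> bump x = 0.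
Proof.
rewrite /bump /flat ler_normr => x1.
case: (ltP 0 x) => x0; last by rewrite mul0r.
by rewrite ifF ?mulr0//; apply/negbTE; rewrite -leNgt; lra.
Qed.

Lemma bump_neq0 x : 0 < x < 1 -> bump x != 0.
Proof.
move=> x01; rewrite /bump /flat !ifT; [|lra..].
by rewrite !hornerC !mul1r mulf_neq0// gt_eqF// expR_gt0.
Qed.

(** If the integral vanished, f^2 would vanish almost everywhere, hence at some
    point of the interval ]0, 1[, which has measure 1. *)
Lemma Rintegral_sqr_gt0 f : test_function f ->
  (forall x, 0 < x < 1 -> f x != 0) -> 0 < \int[mu]_x (f x * f x).
Proof.
move=> tf f0.
have iff := integrable_continuousM_test f f (test_function_continuous _ tf) tf.
rewrite lt_neqAle Rintegral_ge0 => [|x _]; last by rewrite -expr2 sqr_ge0.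
rewrite andbT; apply/negP => /eqP If0.
have [mff _] := integrableP _ _ _ iff.
have : (\int[mu]_x `|(f x * f x)%:E| = 0)%E.
  transitivity (\int[mu]_x (f x * f x)%:E)%E.
    by apply: eq_integral => x _ /=; rewrite ger0_norm// -expr2 sqr_ge0.
  have : (\int[mu]_x (f x * f x)%:E)%E \is a fin_num by exact: integrable_fin_num.
  by move=> /fineK <-; rewrite [fine _](_ : _ = 0).
move=> /(ae_eq_integral_abs _ measurableT mff) [N [mN N0 fN]].
have : (mu `]0%R, 1%R[%classic <= mu N)%E.
  apply: le_measure; rewrite ?inE//.
  move=> x /=; rewrite in_itv/= => x01; apply: fN => /= /(_ I) [].
  by apply/eqP; rewrite mulf_neq0// f0.
by rewrite N0 lebesgue_measure_itv/= lte_fin ltr01 sube0 lee_fin ler10.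
Qed.

Lemma elementary_test f M : elementary f -> (forall x, M <= `|x| -> f x = 0) ->
  test_function f.
Proof.
by move=> ef fM; apply: (bounded_support_test_function _ M) => //; exact: elementary_smooth.
Qed.

Lemma modulation_test f k M : elementary f -> (forall x, M <= `|x| -> f x = 0) ->
  test_function (fun x => f x * cos (k * x)) /\
  test_function (fun x => f x * sin (k * x)).
Proof.
move=> ef fM; split; apply: (elementary_test _ M); try by move=> x /fM ->; rewrite mul0r.
- by apply: elementaryM => //; apply: elementary_scale; exact: elementary_cos.
- by apply: elementaryM => //; apply: elementary_scale; exact: elementary_sin.
Qed.

(** The terms in f f' cancel and cos^2 + sin^2 = 1: this is the identity
    Im (u' conj(u)) = k f^2 for u = f e^(ikx). *)
Lemma modulation_wronskian f k x : elementary f ->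
  let a y := f y * cos (k * y) in
  let b y := f y * sin (k * y) in
  a x * derive1 b x - b x * derive1 a x = k * (f x * f x).
Proof.
move=> ef a b.
have [df _ /(_ x) fx] := elementary_derive _ ef.
have kx : is_derive x 1 (fun y => k * y) k.
  have -> : (fun y => k * y) = k *: (id : R -> R) by apply/funext.
  by apply: is_derive_eq; rewrite /GRing.scale/= mulr1.
have ax : is_derive x 1 a (f x * (- sin (k * x) * k) + cos (k * x) * df x).
  by apply: is_deriveM; exact: is_derive1_comp.
have bx : is_derive x 1 b (f x * (cos (k * x) * k) + sin (k * x) * df x).
  by apply: is_deriveM; exact: is_derive1_comp.
rewrite !derive1E (@derive_val _ _ _ _ _ _ _ ax) (@derive_val _ _ _ _ _ _ _ bx) /a /b.
have := cos2Dsin2 (k * x).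
move: (cos _) (sin _) => C S CS.
transitivity (k * (f x * f x) * (C ^+ 2 + S ^+ 2)); first by ring.
by rewrite CS mulr1.
Qed.

End bump.

Theorem proposition1p2 (R : realType) :
  exists u0 : R -> R[i],
    H1 u0 /\ cLnorm 2 u0 = (Num.sqrt (4 * pi))%:E /\ (0 < P1 u0)%E.
Proof.
pose mu := @lebesgue_measure R.
have tb : test_function (@bump R).
  exact: (elementary_test _ 1 elementary_bump bump_eq0).
pose m := \int[mu]_x (@bump R x * bump x).
have m0 : 0 < m by apply: Rintegral_sqr_gt0 => // x; exact: bump_neq0.
have pi0 : 0 < 4 * pi :> R by rewrite mulr_gt0// pi_gt0.
(* The normalisation gives c * bump the mass 4 pi. *)
pose c := Num.sqrt (4 * pi / m).
pose f (x : R) := c * bump x.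
have ef : elementary f.
  by apply: elementaryM; [exact: elementary_cst|exact: elementary_bump].
have f0 x : 1 <= `|x| -> f x = 0 by move=> /bump_eq0; rewrite /f => ->; rewrite mulr0.
have tf := elementary_test _ 1 ef f0.
have iff := integrable_continuousM_test f f (test_function_continuous _ tf) tf.
have mass : \int[mu]_x (f x * f x) = 4 * pi.
  transitivity (\int[mu]_x (c ^+ 2 * (@bump R x * bump x))).
    by apply: eq_Rintegral => x _; rewrite /f; ring.
  rewrite RintegralZl//; last first.
    by apply: integrable_continuousM_test => //; exact: test_function_continuous.
  by rewrite sqr_sqrtr ?(divr_ge0 (ltW pi0) (ltW m0))// divfK// gt_eqF.
pose N := \int[mu]_x (f x * f x) ^+ 2.
have N0 : 0 <= N by apply: Rintegral_ge0 => x _; exact: sqr_ge0.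
pose k := N + 1.
have [ta tb'] := modulation_test f k 1 ef f0.
have sq x : (f x * cos (k * x)) ^+ 2 + (f x * sin (k * x)) ^+ 2 = f x * f x.
  have := cos2Dsin2 (k * x); move: (cos _) (sin _) (f x) => C S F.
  by rewrite !exprMn -mulrDr => ->; rewrite mulr1 expr2.
exists (fun x => (f x * cos (k * x)) +i* (f x * sin (k * x))); split.
  exact: test_H1.
split.
  rewrite (@cLnormE _ _ 2)//; last first.
    by apply: eq_integrable iff => // x _; rewrite sqr_normc_ReIm /= sq.
  under eq_Rintegral do rewrite sqr_normc_ReIm /= sq.
  by rewrite mass powR12_sqrt// ltW.
rewrite P1_test// lte_fin.
under eq_Rintegral do rewrite modulation_wronskian//.
rewrite RintegralZl// mass.
under eq_Rintegral do rewrite sq.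
rewrite -/N /k; have := @pi_ge2 R; nra.
Qed.
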